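(* Let $n,m_1,\dots,m_n$ be positive integers, $M=m_1+\dots+m_n$, let $f_1,\dots,f_n\in\mathbb{C}$ be nonzero with $z_j=e^{f_j}$ ($j=1,\dots,n$) pairwise distinct, and let $c_{js}\in\mathbb{C}$ ($1\le j\le n$, $0\le s\le m_j-1$) with $c_{j,m_j-1}\neq 0$ for every $j$. Put $$h(k)=\sum_{j=1}^{n}\sum_{s=0}^{m_j-1}c_{js}\,k^s z_j^k,\qquad k\in\{0,1,2,\dots\},\quad 0^0=1.$$ Let $k_0\ge 0$ and $N\ge M$ be integers. Then the zeros of the Prony polynomial $P$, with their multiplicities, are exactly the eigenvalues, with the same multiplicities, of the $M\times M$ matrix pencil $$\mathbf{H}_{MM}(z)=(\mathbf{H}_{NM}^{k_0})^*\bigl(\mathbf{H}_{NM}^{k_0+1}-z\,\mathbf{H}_{NM}^{k_0}\bigr).$$ Moreover, the coefficients $c_{js}$ are the solution of the linear system $$\mathbf{K}_M^{k_0}\,\mathbf{c}=\mathbf{h}^{k_0},$$ where $\mathbf{c}=[c_{1,0},\dots,c_{1,m_1-1},\dots,c_{n,0},\dots,c_{n,m_n-1}]^T$, $\mathbf{h}^{k_0}=[h(k_0),h(k_0+1),\dots,h(k_0+M-1)]^T$, and $\mathbf{K}_M^{k_0}$ is the Casorati matrix.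
   Context: For integers $\kappa\ge 0$, $\mathbf{H}_{NM}^{\kappa}$ denotes the $N\times M$ Hankel matrix whose $(i,l)$ entry is $h(\kappa+i+l-2)$, $1\le i\le N$, $1\le l\le M$. The asterisk denotes the conjugate transpose. The Prony polynomial is $P(z)=\prod_{j=1}^{n}(z-z_j)^{m_j}$, the monic polynomial of degree $M$ having $z_j$ as a zero of multiplicity $m_j$. The eigenvalues of the pencil $\mathbf{H}_{MM}(z)$, with multiplicities, are the zeros, with multiplicities, of the polynomial $z\mapsto\det\mathbf{H}_{MM}(z)$. The Casorati matrix $\mathbf{K}_M^{k_0}$ is the $M\times M$ matrix whose rows are indexed by $i=0,\dots,M-1$, with $k_i=k_0+i$, and whose $i$-th row is $$\bigl(z_1^{k_i},\ k_iz_1^{k_i},\ \dots,\ k_i^{m_1-1}z_1^{k_i},\ \dots,\ z_n^{k_i},\ k_iz_n^{k_i},\ \dots,\ k_i^{m_n-1}z_n^{k_i}\bigr),$$ with the convention $0^0=1$. *)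

(* Defs.v *)
From HB Require Import structures.
From mathcomp Require Import all_boot all_order all_algebra.
From mathcomp Require Import complex.
From mathcomp Require Import reals sequences exp trigo.

Set Implicit Arguments.
Unset Strict Implicit.
Unset Printing Implicit Defensive.

Import Order.TTheory GRing.Theory Num.Theory.

Local Open Scope ring_scope.
Local Open Scope sesquilinear_scope.

Definition cexp (R : realType) (f : R[i]) : R[i] :=
  Complex (expR (complex.Re f) * cos (complex.Im f))
          (expR (complex.Re f) * sin (complex.Im f)).

(* Only the values [c j s] with [s < m j] are used.  In a ring [x ^+ 0 = 1] for
   every [x], including [x = 0], which is the convention 0^0 = 1. *)
Definition exp_sum (C : comNzRingType) (n : nat) (m : 'I_n -> nat)
    (z : 'I_n -> C) (c : 'I_n -> nat -> C) (k : nat) : C :=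
  \sum_(j < n) \sum_(s < m j) c j s * k%:R ^+ s * z j ^+ k.

Definition prony_poly (C : comNzRingType) (n : nat) (m : 'I_n -> nat)
    (z : 'I_n -> C) : {poly C} :=
  \prod_(j < n) ('X - (z j)%:P) ^+ m j.

(* Indices start at 0, whence [k + i + l] for h(k + i + l - 2). *)
Definition hankel (C : Type) (h : nat -> C) (k N M : nat) : 'M[C]_(N, M) :=
  \matrix_(i < N, l < M) h (k + i + l)%N.

(* The pencil z |-> (H^k)^* (H^(k+1) - z H^k), as a matrix of polynomials in the
   indeterminate z; see [horner_hankel_pencil]. *)
Definition hankel_pencil (C : numClosedFieldType) (h : nat -> C)
    (k N M : nat) : 'M[{poly C}]_M :=
  map_mx polyC ((hankel h k N M)^t*) *m
  (map_mx polyC (hankel h k.+1 N M) - 'X *: map_mx polyC (hankel h k N M)).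

Definition casorati (C : comNzRingType) (n : nat) (m : 'I_n -> nat)
    (z : 'I_n -> C) (k0 : nat) :
    'M[C]_(\sum_(j < n) m j, \sum_(j < n) m j) :=
  \mxrow_(j < n)
    \matrix_(i < \sum_(j' < n) m j', s < m j)
      ((k0 + i)%:R ^+ s * z j ^+ (k0 + i)).

Definition coef_vec (C : Type) (n : nat) (m : 'I_n -> nat)
    (c : 'I_n -> nat -> C) : 'cV[C]_(\sum_(j < n) m j) :=
  \mxcol_(j < n) \col_(s < m j) c j s.

Definition sample_vec (C : Type) (h : nat -> C) (k0 M : nat) : 'cV[C]_M :=
  \col_(i < M) h (k0 + i)%N.

Lemma horner_hankel_pencil (C : numClosedFieldType) (h : nat -> C)
    (k N M : nat) (w : C) :
  map_mx (horner_eval w) (hankel_pencil h k N M) =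
  (hankel h k N M)^t* *m (hankel h k.+1 N M - w *: hankel h k N M).
Proof.
have evC p q (A : 'M[C]_(p, q)) : map_mx (horner_eval w) (map_mx polyC A) = A.
  by apply/matrixP => i j; rewrite !mxE /horner_eval hornerC.
by rewrite /hankel_pencil map_mxM map_mxB map_mxZ !evC /= /horner_eval hornerX.
Qed.

Lemma horner_det_hankel_pencil (C : numClosedFieldType) (h : nat -> C)
    (k N M : nat) (w : C) :
  (\det (hankel_pencil h k N M)).[w] =
  \det ((hankel h k N M)^t* *m (hankel h k.+1 N M - w *: hankel h k N M)).
Proof. by rewrite -horner_hankel_pencil det_map_mx. Qed.

(* Main.v *)
Require Import Defs.
From HB Require Import structures.
From mathcomp Require Import all_boot all_order all_algebra.
From mathcomp Require Import complex.
From mathcomp Require Import reals exp trigo.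

Set Implicit Arguments.
Unset Strict Implicit.
Unset Printing Implicit Defensive.

Import Order.TTheory GRing.Theory Num.Theory.

Local Open Scope ring_scope.
Local Open Scope sesquilinear_scope.

(** Everything is read off one linear functional on polynomials. Let theta be the
Euler operator p |-> X p'. Since theta^s X^k = k^s X^k, the samples h(k) are the
moments L(X^k) of
  L(p) = \sum_j \sum_(s < m_j) c_js (theta^s p)(z_j).
If p vanishes to order r at a, then (theta^s p)(a) = 0 for s < r, whereas
(theta^r p)(a) is a nonzero multiple of the leading Taylor coefficient as soon
as a != 0 (lemmas [iter_euler_low] and [iter_euler_top]). Two consequences:

- L kills every multiple of the Prony polynomial P. Expanded in coefficients,
  L(X^k P) = 0 is the linear recurrence satisfied by h, which says that the
  shifted Hankel matrix is H^(k+1) = H^k C, with C the transposed companion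
  matrix of P. The pencil is therefore (H^k)^* H^k (C - z), and its determinant
  is (-1)^M det((H^k)^* H^k) P(z).

- A nonzero polynomial p of degree < M = deg P is not divisible by P, so it has
  at some z_j a zero of order r < m_j. The first nonvanishing theta-derivative
  there shows that no nonzero row vector annihilates the Casorati matrix, and p can
  be multiplied by some q so that p q vanishes to order m_j - 1 exactly at z_j
  and to order at least m_i at the other z_i; then L(p q) is a nonzero multiple of
  c_(j, m_j - 1). As L only depends on q modulo P, the q can be taken of degree
  < M <= N, which is exactly injectivity of H^k. So the Gram matrix
  (H^k)^* H^k is invertible, and the determinant of the pencil is a nonzero
  scalar times P.

The last claim holds because c solves the Casorati system by definition of h and
the matrix of the system is invertible. *)

(** * The Euler operator *)

Definition euler (C : comNzRingType) (p : {poly C}) : {poly C} := 'X * p^`().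

Section Euler.
Variable C : comNzRingType.
Implicit Types (p q u : {poly C}) (a : C).

Lemma iter_euler_is_linear s : linear (iter s (@euler C)).
Proof.
elim: s => [|s IHs] a p q //=.
by rewrite IHs /euler derivD derivZ mulrDr scalerAr.
Qed.

HB.instance Definition _ s :=
  GRing.isLinear.Build C {poly C} {poly C} _ (iter s (@euler C))
    (iter_euler_is_linear s).

Lemma iter_euler_Xn s k : iter s (@euler C) 'X^k = k%:R ^+ s *: 'X^k.
Proof.
elim: s => [|s IHs] /=; first by rewrite expr0 scale1r.
rewrite IHs /euler derivZ derivXn -scalerAr mulrnAr -scaler_nat scalerA -exprSr.
by case: k {IHs} => [|k]; rewrite ?exprS ?mul0r ?scale0r.
Qed.

Lemma euler_mul_XsubCX p a r :
  euler (p * ('X - a%:P) ^+ r.+1) =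
  (euler p * ('X - a%:P) + 'X * p *+ r.+1) * ('X - a%:P) ^+ r.
Proof.
rewrite /euler derivM deriv_exp derivXsubC mul1r /= mulrDr mulrDl.
congr (_ + _); first by rewrite exprS !mulrA.
by rewrite !mulrnAr mulrnAl mulrA.
Qed.

(** Each application of theta lowers the order of vanishing by at most one. *)
Lemma iter_euler_low s r p a : (s < r)%N ->
  (iter s (@euler C) (p * ('X - a%:P) ^+ r)).[a] = 0.
Proof.
elim: s r p => [|s IHs] [|r] p //= lt_sr.
  by rewrite exprS mulrCA hornerM hornerXsubC subrr mul0r.
by rewrite -iterS iterSr euler_mul_XsubCX IHs.
Qed.

(** By [euler_mul_XsubCX], one application of theta to p (X - a)^(r+1) leaves a
    factor (X - a)^r whose cofactor takes the value (r+1) a p(a) at a; iterating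
    down to r = 0 collects the factorial and the power of a. *)
Lemma iter_euler_top r p a :
  (iter r (@euler C) (p * ('X - a%:P) ^+ r)).[a] = a ^+ r * p.[a] *+ r`!.
Proof.
elim: r p => [|r IHr] p; first by rewrite expr0 mulr1 mul1r.
rewrite iterSr euler_mul_XsubCX IHr hornerD hornerM hornerXsubC subrr mulr0.
by rewrite add0r hornerMn hornerM hornerX mulrnAr -mulrnA -factS mulrA exprSr.
Qed.

End Euler.

(** * The functional whose moments are the samples *)

Definition exp_functional (C : comNzRingType) (n : nat) (m : 'I_n -> nat)
    (z : 'I_n -> C) (c : 'I_n -> nat -> C) (p : {poly C}) : C :=
  \sum_(j < n) \sum_(s < m j) c j s * (iter s (@euler C) p).[z j].

Section Functional.
Variables (C : comNzRingType) (n : nat) (m : 'I_n -> nat).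
Variables (z : 'I_n -> C) (c : 'I_n -> nat -> C).

Lemma exp_functional_is_linear : linear_for *%R (exp_functional m z c).
Proof.
move=> a p q; rewrite /exp_functional mulr_sumr -big_split /=.
apply: eq_bigr => j _; rewrite mulr_sumr -big_split /=.
by apply: eq_bigr => s _; rewrite linearP hornerD hornerZ mulrDr mulrCA.
Qed.

HB.instance Definition _ :=
  GRing.isLinear.Build C {poly C} C _ (exp_functional m z c)
    exp_functional_is_linear.

Lemma exp_functional_Xn k : exp_functional m z c 'X^k = exp_sum m z c k.
Proof.
apply: eq_bigr => j _; apply: eq_bigr => s _.
by rewrite iter_euler_Xn hornerZ hornerXn mulrA.
Qed.

Lemma exp_functional_mul_prony p :
  exp_functional m z c (p * prony_poly m z) = 0.
Proof.
rewrite /exp_functional big1 // => j _; rewrite big1 // => s _.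
rewrite /prony_poly (bigD1 j) //= [_ ^+ _ * _]mulrC mulrA.
by rewrite iter_euler_low ?mulr0.
Qed.

(** The coefficients of P are those of the recurrence, as h(k + l) is the moment
    of X^k X^l. *)
Lemma exp_sum_prony_recurrence k :
  \sum_(l < size (prony_poly m z)) (prony_poly m z)`_l *
    exp_sum m z c (k + l)%N = 0.
Proof.
apply: etrans (exp_functional_mul_prony 'X^k).
rewrite -[X in _ = exp_functional _ _ _ (_ * X)]coefK poly_def.
rewrite mulr_sumr linear_sum; apply: eq_bigr => l _.
by rewrite -scalerAr -exprD linearZ /= exp_functional_Xn.
Qed.

Lemma prony_poly_monic : prony_poly m z \is monic.
Proof. by apply: monic_prod => j _; rewrite monic_exp ?monicXsubC. Qed.

End Functional.

Lemma size_prony_poly (C : idomainType) n (m : 'I_n -> nat) (z : 'I_n -> C) :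
  size (prony_poly m z) = (\sum_(j < n) m j).+1.
Proof.
rewrite /prony_poly size_prod => [|j _]; last first.
  by rewrite expf_neq0 ?polyXsubC_eq0.
under eq_bigr do rewrite size_exp_XsubC -addn1.
by rewrite big_split sum1_card /= -addSn addnK.
Qed.

Section Nondegenerate.
Variables (C : numFieldType) (n : nat) (m : 'I_n -> nat).
Variable z : 'I_n -> C.
Hypothesis z_inj : injective z.

(** Powers of X - z_j at distinct points are pairwise coprime. *)
Lemma prony_poly_dvd (p : {poly C}) :
  (forall j, ('X - (z j)%:P) ^+ m j %| p) -> prony_poly m z %| p.
Proof.
move=> dvd_p; rewrite /prony_poly.
elim: (index_enum _) (index_enum_uniq 'I_n) => [|j s IHs] /=.
  by rewrite big_nil dvd1p.
case/andP=> js uniq_s; rewrite big_cons Gauss_dvdp ?dvd_p ?IHs //.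
rewrite big_seq; elim/big_ind: _ => [|p1 p2 co1 co2|i si].
- exact: coprimep1.
- by rewrite coprimepMr co1.
apply/coprimep_expl/coprimep_expr/coprimep_XsubC2.
rewrite subr_eq0 (inj_eq z_inj).
by apply: contraNneq js => <-.
Qed.

Lemma exists_zero_of_low_order (p : {poly C}) :
  p != 0 -> (size p <= \sum_(j < n) m j)%N ->
  exists j r, exists2 q, (r < m j)%N && (q.[z j] != 0)
    & p = q * ('X - (z j)%:P) ^+ r.
Proof.
move=> p0 sz_p.
have [j Ndvd|dvd] := pickP (fun j => ~~ (('X - (z j)%:P) ^+ m j %| p));
    last first.
  have /dvdp_leq : prony_poly m z %| p.
    by apply: prony_poly_dvd => j; have /negbFE := dvd j.
  by rewrite size_prony_poly => /(_ p0); rewrite ltnNge sz_p.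
have [r [q]] := multiplicity_XsubC p (z j); rewrite p0 /= => q_z p_eq.
exists j, r, q; rewrite // q_z andbT ltnNge.
by apply: contra Ndvd => le_mr; rewrite p_eq dvdp_mull ?dvdp_exp2l.
Qed.

Hypothesis z_neq0 : forall j, z j != 0.

(** The factor X^k, a unit near each z_j, accounts for sampling from index k on;
    this is where z_j != 0 is used. *)
Lemma exists_iter_euler_neq0 (k : nat) (p : {poly C}) :
  p != 0 -> (size p <= \sum_(j < n) m j)%N ->
  exists j s,
    (s < m j)%N && ((iter s (@euler C) ('X^k * p)).[z j] != 0).
Proof.
move=> p0 /(exists_zero_of_low_order p0) [j [r [q /andP[ltrm q_z] ->]]].
exists j, r; rewrite ltrm mulrA iter_euler_top hornerM hornerXn -mulr_natr.
by rewrite !mulf_neq0 ?expf_neq0 // pnatr_eq0 -lt0n fact_gt0.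
Qed.

(** The bilinear form (p, q) |-> L(X^k p q) is nondegenerate modulo P: the
    multiplier q raises the order of vanishing of p to one less than P has at a
    single z_j, so that only the top coefficient at z_j survives in L. *)
Lemma exp_functional_nondegenerate (c : 'I_n -> nat -> C) (k : nat)
    (p : {poly C}) :
  (forall j, c j (m j).-1 != 0) ->
  p != 0 -> (size p <= \sum_(j < n) m j)%N ->
  exists q, exp_functional m z c ('X^k * p * q) != 0.
Proof.
move=> hc p0 /(exists_zero_of_low_order p0) [j [r [u /andP[ltrm u_z] ->]]].
have m_gt0 : (0 < m j)%N by apply: leq_ltn_trans ltrm.
pose P' := \prod_(i < n | i != j) ('X - (z i)%:P) ^+ m i.
exists (('X - (z j)%:P) ^+ ((m j).-1 - r) * P').
set v := 'X^k * u * P'.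
have -> : 'X^k * (u * ('X - (z j)%:P) ^+ r) *
    (('X - (z j)%:P) ^+ ((m j).-1 - r) * P') = v * ('X - (z j)%:P) ^+ (m j).-1.
  have -> : ('X - (z j)%:P) ^+ (m j).-1 =
      ('X - (z j)%:P) ^+ ((m j).-1 - r) * ('X - (z j)%:P) ^+ r.
    by rewrite -exprD subnK // -ltnS prednK.
  by rewrite /v -!mulrA; congr (_ * (_ * _)); rewrite mulrC mulrAC mulrC.
rewrite /exp_functional (bigD1 j) //= [X in _ + X]big1 ?addr0 => [|i ij].
  have mj1 : ((m j).-1 < m j)%N by rewrite prednK.
  rewrite (bigD1 (Ordinal mj1)) //= big1 ?addr0 => [|s sj].
    rewrite iter_euler_top /v /P' !hornerM hornerXn horner_prod -mulr_natr.
    rewrite !mulf_neq0 ?expf_neq0 ?pnatr_eq0 -?lt0n ?fact_gt0 //.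
    apply/prodf_neq0 => i ij; rewrite horner_exp hornerXsubC expf_neq0 //.
    by rewrite subr_eq0 (inj_eq z_inj) eq_sym.
  rewrite iter_euler_low ?mulr0 // ltn_neqAle -ltnS prednK // ltn_ord andbT.
  by apply: contraNneq sj => sj; apply/eqP/val_inj.
apply: big1 => s _.
rewrite /v /P' (bigD1 i) //= [_ ^+ _ * \prod_(_ < _ | _) _]mulrC mulrA.
rewrite mulrAC.
by rewrite iter_euler_low ?mulr0.
Qed.

End Nondegenerate.

(** * Casorati matrix, Hankel matrices and the pencil *)

Lemma rVpoly_sum (C : comNzRingType) d (u : 'rV[C]_d) :
  rVpoly u = \sum_(i < d) u 0 i *: 'X^i.
Proof.
rewrite [u in LHS]row_sum_delta linear_sum; apply: eq_bigr => i _.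
by rewrite linearZ /= rVpoly_delta.
Qed.

(** A row vector in the left kernel, read as a polynomial y, would make all
    theta^s (X^k y), s < m_j, vanish at every z_j, although y has degree < M. *)
Lemma det_casorati_neq0 (C : numFieldType) n (m : 'I_n -> nat)
    (z : 'I_n -> C) (k : nat) :
  injective z -> (forall j, z j != 0) -> \det (casorati m z k) != 0.
Proof.
move=> z_inj z_neq0; apply/det0P => -[y y0 yK].
have p0 : rVpoly y != 0.
  by apply: contraNneq y0 => p0; rewrite -(rVpolyK y) p0 linear0.
have [j [s /andP[lts]]] :=
  exists_iter_euler_neq0 z_inj z_neq0 k p0 (size_poly _ _).
case/eqP; rewrite rVpoly_sum mulr_sumr linear_sum horner_sum.
have /(congr1 (fun A => submxrow A j 0 (Ordinal lts))) := yK.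
rewrite /casorati mul_mxrow mxrowK submxrow0 !mxE => yK0.
rewrite -[RHS]yK0; apply: eq_bigr => i _.
by rewrite !mxE -scalerAr -exprD linearZ /= iter_euler_Xn !hornerZ hornerXn.
Qed.

Lemma casorati_coef_vec (C : comNzRingType) n (m : 'I_n -> nat)
    (z : 'I_n -> C) (c : 'I_n -> nat -> C) (k : nat) :
  casorati m z k *m coef_vec m c = sample_vec (exp_sum m z c) k _.
Proof.
rewrite /casorati /coef_vec mul_mxrow_mxcol; apply/colP => i.
rewrite summxE !mxE; apply: eq_bigr => j _; rewrite !mxE.
by apply: eq_bigr => s _; rewrite !mxE mulrC mulrA.
Qed.

Lemma hankel_mul_col (C : comNzRingType) n (m : 'I_n -> nat)
    (z : 'I_n -> C) (c : 'I_n -> nat -> C) (k N d : nat) (u : 'cV[C]_d)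
    (i : 'I_N) :
  (hankel (exp_sum m z c) k N d *m u) i 0 =
  exp_functional m z c ('X^k * rVpoly u^T * 'X^i).
Proof.
rewrite mxE rVpoly_sum mulr_sumr mulr_suml linear_sum.
apply: eq_bigr => l _; rewrite !mxE -scalerAr -scalerAl -!exprD linearZ /=.
by rewrite exp_functional_Xn mulrC addnAC.
Qed.

(** The N entries of the product are the values L(X^k u X^i), i < N. Since N is at
    least deg P, they determine L(X^k u q) for every q, by reducing q modulo P;
    nondegeneracy concludes. *)
Lemma hankel_mul_inj (C : numFieldType) n (m : 'I_n -> nat)
    (z : 'I_n -> C) (c : 'I_n -> nat -> C) (k N : nat)
    (u : 'cV[C]_(\sum_(j < n) m j)) :
  injective z -> (forall j, z j != 0) -> (forall j, c j (m j).-1 != 0) ->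
  (\sum_(j < n) m j <= N)%N ->
  hankel (exp_sum m z c) k N _ *m u = 0 -> u = 0.
Proof.
move=> z_inj z_neq0 c_top leMN Hu.
apply/eqP/contraT => u0.
have p0 : rVpoly u^T != 0.
  apply: contraNneq u0 => p0; rewrite -[u]trmxK -(rVpolyK u^T) p0.
  by rewrite linear0 trmx0.
have [q /eqP[]] :=
  exp_functional_nondegenerate z_inj z_neq0 k c_top p0 (size_poly _ _).
have P0 : prony_poly m z != 0 by rewrite monic_neq0 ?prony_poly_monic.
rewrite (divp_eq q (prony_poly m z)) mulrDr mulrA linearD /=.
rewrite exp_functional_mul_prony add0r.
have sz_r : (size (q %% prony_poly m z)%R <= N)%N.
  apply: leq_trans leMN; rewrite -ltnS -(size_prony_poly m z).
  by rewrite ltn_modp.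
rewrite -(poly_rV_K sz_r) [X in _ * X]rVpoly_sum mulr_sumr linear_sum.
rewrite big1 // => i _.
by rewrite -scalerAr linearZ /= -hankel_mul_col Hu [X in _ * X]mxE mulr0.
Qed.

(** A row v killing A^* A satisfies |v A^*|^2 = 0, so that its conjugate transpose
    is killed by A. *)
Lemma det_gram_neq0 (C : numClosedFieldType) p q (A : 'M[C]_(p, q)) :
  (forall u : 'cV_q, A *m u = 0 -> u = 0) -> \det (A^t* *m A) != 0.
Proof.
move=> A_inj; apply/det0P => -[v v0 vAA].
have : dotmx (v *m A^t*) (v *m A^t*) = 0.
  by rewrite dotmxE trmx_mul map_mxM trmxCK mulmxA -(mulmxA v) vAA mul0mx mxE.
move/eqP; rewrite dnorm_eq0 => /eqP vA.
have /A_inj v'0 : A *m v^t* = 0.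
  by rewrite -[A]trmxCK -map_mxM -trmx_mul vA trmx0 map_mx0.
by case/eqP: v0; rewrite -[v]trmxCK v'0 trmx0 map_mx0.
Qed.

(** Multiplication by the transposed companion matrix moves every column of the
    Hankel matrix one step left, and the recurrence produces the last column. *)
Lemma hankel_shift (C : comNzRingType) (h : nat -> C) (p : {poly C})
    (k N : nat) :
  p \is monic ->
  (forall k, \sum_(l < size p) p`_l * h (k + l)%N = 0) ->
  hankel h k.+1 N (size p).-1 = hankel h k N (size p).-1 *m (companionmx p)^T.
Proof.
move=> p_monic h_rec; apply/matrixP => i l; rewrite !mxE.
have sz_p : size p = (size p).-1.+1.
  by rewrite prednK // size_poly_gt0 monic_neq0.
(* The last row of the companion matrix carries the coefficients of p; the
   other rows form a shift. *)
case: (ltnP l.+1 (size p).-1) => [lt_ld|le_dl].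
  rewrite (bigD1 (Ordinal lt_ld)) //= big1 => [|j jl]; rewrite !mxE /=.
    rewrite ltn_eqF ?eqxx ?mulr1 ?addr0; last first.
      by rewrite -ltnS prednK // (ltn_trans _ lt_ld).
    by rewrite addSn addSnnS.
  rewrite ltn_eqF; last by rewrite -ltnS prednK // (ltn_trans _ lt_ld).
  by rewrite eq_sym -[l.+1]/(val (Ordinal lt_ld)) val_eqE (negPf jl) mulr0.
have l_last : l.+1 = (size p).-1 by apply/eqP; rewrite eqn_leq ltn_ord.
have /eqP := h_rec (k + i)%N; rewrite [in X in X -> _]sz_p big_ord_recr /=.
rewrite -[p`_(size p).-1]/(lead_coef p) (monicP p_monic) mul1r.
rewrite addrC addr_eq0 => /eqP h_last.
rewrite !addSn -addnS l_last h_last -sumrN; apply: eq_bigr => j _.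
by rewrite !mxE -(congr1 predn l_last) eqxx mulrN mulrC.
Qed.

Lemma det_hankel_pencil (C : numClosedFieldType) (h : nat -> C)
    (p : {poly C}) (k N : nat) (A := hankel h k N (size p).-1) :
  p \is monic ->
  (forall k, \sum_(l < size p) p`_l * h (k + l)%N = 0) ->
  \det (hankel_pencil h k N (size p).-1) =
  ((-1) ^+ (size p).-1 * \det (A^t* *m A)) *: p.
Proof.
move=> p_monic h_rec.
have det_comp : \det (map_mx polyC (companionmx p)^T - 'X%:M) =
    (-1) ^+ (size p).-1 * p.
  rewrite -[X in _ = _ * X](companionmxK p_monic) /char_poly /char_poly_mx.
  rewrite -det_tr linearB /= tr_scalar_mx map_trmx trmxK.
  by rewrite -opprB -scaleN1r detZ.
rewrite /hankel_pencil -/A (hankel_shift k N p_monic) // -/A map_mxM.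
rewrite -mul_mx_scalar -mulmxBr mulmxA -map_mxM det_mulmx det_comp det_map_mx.
rewrite -mul_polyC polyCM rmorphXn rmorphN1 mulrA.
by congr (_ * _); rewrite mulrC.
Qed.

(** * Prony's theorem *)

Lemma cexp_neq0 (R : realType) (f : R[i]) : cexp f != 0.
Proof.
rewrite eq_complex /= !mulf_eq0 !expR_eq0 /=.
apply/negP => /andP[/eqP cos0 /eqP sin0].
have := cos2Dsin2 (complex.Im f).
by rewrite cos0 sin0 expr0n addr0 => /eqP; rewrite eq_sym oner_eq0.
Qed.

Theorem theorem2p2 (R : realType) (n : nat) (m : 'I_n -> nat)
    (f z : 'I_n -> R[i]) (c : 'I_n -> nat -> R[i]) (k0 N : nat)
    (hn : (0 < n)%N)
    (hm : forall j : 'I_n, (0 < m j)%N)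
    (hf : forall j : 'I_n, f j != 0)
    (hz : forall j : 'I_n, z j = cexp (f j))
    (hinj : forall j1 j2 : 'I_n, j1 != j2 -> z j1 != z j2)
    (hc : forall j : 'I_n, c j (m j).-1 != 0)
    (hN : (\sum_(j < n) m j <= N)%N) :
  let M := (\sum_(j < n) m j)%N in
  let h := exp_sum m z c in
  [/\ \det (hankel_pencil h k0 N M) != 0,
      forall w : R[i],
        mup w (prony_poly m z) = mup w (\det (hankel_pencil h k0 N M))
    & forall x : 'cV[R[i]]_M,
        casorati m z k0 *m x = sample_vec h k0 M <-> x = coef_vec m c].
Proof.
move=> M h.
have z_neq0 j : z j != 0 by rewrite hz cexp_neq0.
have z_inj : injective z.
  by move=> i j; apply: contra_eq => /hinj.
have P_monic : prony_poly m z \is monic by apply: prony_poly_monic.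
have [a a0 det_eq] : exists2 a, a != 0
    & \det (hankel_pencil h k0 N M) = a *: prony_poly m z.
  have sz_P : (size (prony_poly m z)).-1 = M by rewrite size_prony_poly.
  exists ((-1) ^+ M * \det ((hankel h k0 N M)^t* *m hankel h k0 N M)).
    rewrite mulf_neq0 ?expf_neq0 ?oppr_eq0 ?oner_eq0 //.
    by apply: det_gram_neq0 => u; apply: hankel_mul_inj.
  by rewrite -sz_P det_hankel_pencil //; apply: exp_sum_prony_recurrence.
split=> [|w|x]; rewrite ?det_eq.
- by rewrite scaler_eq0 negb_or a0 monic_neq0.
- by rewrite -mul_polyC mupMr // rootC.
- have K_unit : casorati m z k0 \in unitmx.
    by rewrite unitmxE unitfE det_casorati_neq0.
  rewrite -(casorati_coef_vec m z c k0); split=> [|-> //].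
  exact: (can_inj (mulKmx K_unit)).
Qed.
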